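(* Let $H = (H,\mu_H,\Delta_H,\alpha_H)$ be a Hom-bialgebra, $A = (A,\mu_A,\alpha_A)$ be a Hom-associative algebra, and $\rho \colon H \otimes A \to A$ be an $H$-module Hom-algebra structure on $A$ (all over $\mathbf{k}$). For any integers $n,k \geq 0$, define the map \[ \rho^{n,k} = \alpha_A^{2^k-1} \circ \rho \circ (\alpha_H^n \otimes Id_A) \colon H \otimes A \to A. \] Then $\rho^{n,k}$ gives $A^k$ the structure of an $H^k$-module Hom-algebra, where $A^k$ is the Hom-associative algebra $(A,\ \mu_A^{(k)} = \alpha_A^{2^k-1} \circ \mu_A,\ \alpha_A^{2^k})$ and $H^k$ is the Hom-bialgebra $(H,\ \mu_H^{(k)} = \alpha_H^{2^k-1} \circ \mu_H,\ \Delta_H^{(k)} = \Delta_H \circ \alpha_H^{2^k-1},\ \alpha_H^{2^k})$.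
   Context: $\mathbf{k}$ is a fixed associative and commutative ring of characteristic $0$; modules, tensor products and linear maps are over $\mathbf{k}$. For a self-map $\alpha$, $\alpha^n$ is the $n$-fold composition, $\alpha^0 = Id$. $\tau(v\otimes w)=w\otimes v$ is the twist isomorphism. $\Delta(x)=\sum_{(x)} x_1\otimes x_2$ is Sweedler's notation. A Hom-associative algebra $(A,\mu,\alpha)$ is a $\mathbf{k}$-module $A$ with linear maps $\mu\colon A^{\otimes 2}\to A$, $\alpha\colon A\to A$ such that $\alpha\circ\mu=\mu\circ\alpha^{\otimes 2}$ and $\mu\circ(\alpha\otimes\mu)=\mu\circ(\mu\otimes\alpha)$. A Hom-coassociative coalgebra $(C,\Delta,\alpha)$ is a $\mathbf{k}$-module $C$ with linear maps $\Delta\colon C\to C^{\otimes 2}$, $\alpha\colon C\to C$ such that $\alpha^{\otimes 2}\circ\Delta=\Delta\circ\alpha$ and $(\alpha\otimes\Delta)\circ\Delta=(\Delta\otimes\alpha)\circ\Delta$. A Hom-bialgebra $(H,\mu,\Delta,\alpha)$ is such that $(H,\mu,\alpha)$ is a Hom-associative algebra, $(H,\Delta,\alpha)$ is a Hom-coassociative coalgebra, and $\Delta\circ\mu=\mu^{\otimes 2}\circ(Id\otimes\tau\otimes Id)\circ\Delta^{\otimes 2}$. An $H$-module (for the Hom-associative algebra $(H,\mu_H,\alpha_H)$) is a pair $(M,\alpha_M)$ of a $\mathbf{k}$-module and a linear self-map, with a linear structure map $\rho\colon H\otimes M\to M$ such that $\alpha_M\circ\rho=\rho\circ(\alpha_H\otimes\alpha_M)$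 and $\rho\circ(\alpha_H\otimes\rho)=\rho\circ(\mu_H\otimes\alpha_M)$. For a Hom-bialgebra $(H,\mu_H,\Delta_H,\alpha_H)$ and a Hom-associative algebra $(A,\mu_A,\alpha_A)$, an $H$-module Hom-algebra structure on $A$ is an $H$-module structure $\rho\colon H\otimes A\to A$ on $(A,\alpha_A)$, written $\rho(x,a)=xa$, such that the module Hom-algebra axiom $\alpha_H^2(x)(ab)=\sum_{(x)}(x_1a)(x_2b)$ holds for all $x\in H$ and $a,b\in A$, where $ab=\mu_A(a,b)$ and $\Delta_H(x)=\sum_{(x)}x_1\otimes x_2$. (When applied to $H^k$ and $A^k$, all structure maps in these axioms are those of $H^k$ and $A^k$.) *)

(* Defs.v *)
From HB Require Import structures.
From mathcomp Require Import all_boot all_order all_algebra.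
From mathcomp Require Import boolp.

Set Implicit Arguments.
Unset Strict Implicit.
Unset Printing Implicit Defensive.

Import GRing.Theory.
Local Open Scope ring_scope.
Local Open Scope quotient_scope.

Reserved Notation "U ⊗ V" (at level 40, left associativity).
Reserved Notation "u ⊗e v" (at level 40, left associativity).
Reserved Notation "f ⊗m g" (at level 40, left associativity).

(* U ⊗ V is the free commutative monoid on U * V (lists of pairs, read as
   formal sums of pure tensors) modulo the congruence generated by
   bilinearity; additive inverses and scalars then act on the left factor. *)
Section TensorProduct.
Variables (K : comNzRingType) (U V : lmodType K).
Implicit Types (s t : seq (U * V)).

Inductive tensor_eq : seq (U * V) -> seq (U * V) -> Prop :=
| TensorRefl s : tensor_eq s s
| TensorSym s t : tensor_eq s t -> tensor_eq t s
| TensorTrans s t r : tensor_eq s t -> tensor_eq t r -> tensor_eq s r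
| TensorCat s s' t t' :
    tensor_eq s s' -> tensor_eq t t' -> tensor_eq (s ++ t) (s' ++ t')
| TensorCatC s t : tensor_eq (s ++ t) (t ++ s)
| Tensor0 v : tensor_eq [:: (0, v)] [::]
| TensorDl u u' v : tensor_eq [:: (u + u', v)] [:: (u, v); (u', v)]
| TensorDr u v v' : tensor_eq [:: (u, v + v')] [:: (u, v); (u, v')]
| TensorZ a u v : tensor_eq [:: (a *: u, v)] [:: (u, a *: v)].

Definition tensor_eqb : rel (seq (U * V)) := fun s t => `[< tensor_eq s t >].

Fact tensor_eqb_refl : reflexive tensor_eqb.
Proof. by move=> s; apply/asboolP; apply: TensorRefl. Qed.

Fact tensor_eqb_sym : symmetric tensor_eqb.
Proof. by move=> s t; apply/asboolP/asboolP; apply: TensorSym. Qed.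

Fact tensor_eqb_trans : transitive tensor_eqb.
Proof. by move=> t s r /asboolP st /asboolP /(TensorTrans st) /asboolP. Qed.

Canonical tensor_equiv :=
  EquivRel tensor_eqb tensor_eqb_refl tensor_eqb_sym tensor_eqb_trans.

Definition tensor := {eq_quot tensor_equiv}.
HB.instance Definition _ : EqQuotient _ tensor_equiv tensor :=
  EqQuotient.on tensor.
HB.instance Definition _ := Choice.on tensor.

Definition tens (u : U) (v : V) : tensor := \pi_tensor [:: (u, v)].

Lemma tensor_eqP s t : \pi_tensor s = \pi_tensor t <-> tensor_eq s t.
Proof.
split=> [/eqP|st]; first by rewrite eqmodE => /asboolP.
by apply/eqP; rewrite eqmodE; apply/asboolP.
Qed.

Lemma tensor_pi (x : tensor) : exists s, x = \pi_tensor s.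
Proof. by exists (repr x); rewrite reprK. Qed.

Definition scale_seq (a : K) s := [seq (a *: p.1, p.2) | p <- s].

Lemma tensor_eq_scale a s t :
  tensor_eq s t -> tensor_eq (scale_seq a s) (scale_seq a t).
Proof.
elim=> {s t}.
- by move=> s; apply: TensorRefl.
- by move=> s t _; apply: TensorSym.
- by move=> s t r _ IH1 _; apply: TensorTrans.
- by move=> s s' t t' _ IH1 _ IH2; rewrite /scale_seq !map_cat; apply: TensorCat.
- by move=> s t; rewrite /scale_seq !map_cat; apply: TensorCatC.
- by move=> v /=; rewrite scaler0; apply: Tensor0.
- by move=> u u' v /=; rewrite scalerDr; apply: TensorDl.
- by move=> u v v' /=; apply: TensorDr.
- by move=> b u v /=; rewrite scalerA mulrC -scalerA; apply: TensorZ.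
Qed.

Definition addt (x y : tensor) : tensor := \pi_tensor (repr x ++ repr y).
Definition zerot : tensor := \pi_tensor [::].
Definition scalet (a : K) (x : tensor) : tensor :=
  \pi_tensor (scale_seq a (repr x)).
Definition oppt (x : tensor) : tensor := scalet (-1) x.

Lemma repr_eq s : tensor_eq (repr (\pi_tensor s)) s.
Proof. by apply/tensor_eqP; rewrite reprK. Qed.

Lemma addt_pi s t : addt (\pi_tensor s) (\pi_tensor t) = \pi_tensor (s ++ t).
Proof. by apply/tensor_eqP; apply: TensorCat; apply: repr_eq. Qed.

Lemma scalet_pi a s : scalet a (\pi_tensor s) = \pi_tensor (scale_seq a s).
Proof. by apply/tensor_eqP; apply: tensor_eq_scale; apply: repr_eq. Qed.

Fact addtA : associative addt.
Proof.
move=> x y z; have [s ->] := tensor_pi x; have [t ->] := tensor_pi y; have [r ->] := tensor_pi z.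
by rewrite !addt_pi catA.
Qed.

Fact addtC : commutative addt.
Proof.
move=> x y; have [s ->] := tensor_pi x; have [t ->] := tensor_pi y; rewrite !addt_pi.
by apply/tensor_eqP; apply: TensorCatC.
Qed.

Fact add0t : left_id zerot addt.
Proof. by move=> x; have [s ->] := tensor_pi x; rewrite addt_pi. Qed.

Fact scaletA a b x : scalet a (scalet b x) = scalet (a * b) x.
Proof.
have [s ->] := tensor_pi x; rewrite !scalet_pi; congr \pi.
by rewrite /scale_seq -map_comp; apply: eq_map => p /=; rewrite scalerA.
Qed.

Fact scale1t : left_id 1 scalet.
Proof.
move=> x; have [s ->] := tensor_pi x; rewrite scalet_pi; congr \pi.
by rewrite /scale_seq -[RHS]map_id; apply: eq_map => -[u v] /=; rewrite scale1r.
Qed.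

Fact scaletDr : right_distributive scalet addt.
Proof.
move=> a x y; have [s ->] := tensor_pi x; have [t ->] := tensor_pi y.
by rewrite addt_pi !scalet_pi addt_pi /scale_seq map_cat.
Qed.

Fact scaletDl x a b : scalet (a + b) x = addt (scalet a x) (scalet b x).
Proof.
have [s ->] := tensor_pi x; rewrite !scalet_pi addt_pi; apply/tensor_eqP.
elim: s => [|[u v] s IH] /=; first exact: TensorRefl.
rewrite scalerDl -[_ :: scale_seq _ _]cat1s.
apply: TensorTrans (TensorCat (TensorDl _ _ _) IH) _.
apply: (@TensorCat [:: _] [:: _]); first exact: TensorRefl.
have := TensorCat (TensorCatC [:: (b *: u, v)] (scale_seq a s))
                  (TensorRefl (scale_seq b s)).
by rewrite -!catA.
Qed.

Fact scale0t x : scalet 0 x = zerot.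
Proof.
have [s ->] := tensor_pi x; rewrite scalet_pi; apply/tensor_eqP.
elim: s => [|[u v] s IH] /=; first exact: TensorRefl.
by rewrite -cat1s scale0r; apply: (TensorCat (Tensor0 v) IH).
Qed.

Fact addNt : left_inverse zerot oppt addt.
Proof.
by move=> x; rewrite /oppt -{2}[x]scale1t -scaletDl addNr scale0t.
Qed.

HB.instance Definition _ :=
  GRing.isZmodule.Build tensor addtA addtC add0t addNt.
HB.instance Definition _ :=
  GRing.Zmodule_isLmodule.Build K tensor scaletA scale1t scaletDr scaletDl.

End TensorProduct.

Arguments tens {K U V} u v.
Notation "U ⊗ V" := (tensor U V) : type_scope.
Notation "u ⊗e v" := (tens u v) : ring_scope.

Section Lift.
Variables (K : comNzRingType) (U V W : lmodType K).
Local Notation bilin f := (bilinear_for *:%R *:%R f).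

Lemma linear_at0 (X Y : lmodType K) (g : X -> Y) : linear g -> g 0 = 0.
Proof.
by move=> lg; have := lg (-1) 0 0; rewrite scaler0 addr0 /= scaleN1r addNr.
Qed.

Lemma tens_bilinear : bilin (@tens K U V).
Proof.
have tensZl a u v : (a *: u) ⊗e v = a *: (u ⊗e v) :> (U ⊗ V).
  by rewrite [RHS]scalet_pi.
split=> [v a x y|u a x y].
  rewrite /= -tensZl [RHS]addt_pi; apply/tensor_eqP; exact: TensorDl.
rewrite /= -tensZl [RHS]addt_pi; apply/tensor_eqP.
apply: TensorTrans (TensorDr _ _ _) _.
rewrite -[X in tensor_eq X]cat1s; apply: TensorCat; last exact: TensorRefl.
by apply: TensorSym; apply: TensorZ.
Qed.

(* tlift f sends \sum_i u_i ⊗ v_i to \sum_i f u_i v_i, i.e. it is the sum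
   \sum_(x) f x_1 x_2 in Sweedler's notation.  The representative used is
   irrelevant when f is bilinear (tlift_sum). *)
Definition tlift (f : U -> V -> W) (x : U ⊗ V) : W :=
  \sum_(p <- repr x) f p.1 p.2.

Lemma tlift_pi f : bilin f ->
  forall s, tlift f (\pi_(U ⊗ V) s) = \sum_(p <- s) f p.1 p.2.
Proof.
case=> fl fr s; rewrite /tlift; move: (repr _) (repr_eq s) => t.
elim=> {s t} //=.
- by move=> s1 s2 s3 _ -> _ ->.
- by move=> s1 s2 s3 s4 _ e1 _ e2; rewrite !big_cat /= e1 e2.
- by move=> s1 s2; rewrite !big_cat /= addrC.
- by move=> v; rewrite big_seq1 big_nil /=; exact: linear_at0 (fl v).
- move=> u u' v; rewrite !big_cons !big_nil /= !addr0.
  by rewrite -{1}[u]scale1r fl /= scale1r.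
- move=> u v v'; rewrite !big_cons !big_nil /= !addr0.
  by rewrite -{1}[v]scale1r fr /= scale1r.
- move=> a u v; rewrite !big_seq1 /=.
  have f0 : f 0 v = 0 := linear_at0 (fl v).
  have f0r : f u 0 = 0 := linear_at0 (fr u).
  by rewrite -[a *: u]addr0 -[a *: v]addr0 fl fr f0 f0r.
Qed.

Lemma tlift_linear f : bilin f -> linear (tlift f).
Proof.
move=> bf a x y; have [s ->] := tensor_pi x; have [t ->] := tensor_pi y.
have -> : a *: \pi_(U ⊗ V) s + \pi_(U ⊗ V) t
        = \pi_(U ⊗ V) (scale_seq a s ++ t).
  by rewrite -addt_pi -scalet_pi.
rewrite !tlift_pi // big_cat big_map /= scaler_sumr; congr (_ + _).
apply: eq_bigr => p _.
have f0 : f 0 p.2 = 0 := linear_at0 (bf.1 p.2).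
by rewrite -[a *: p.1]addr0 bf.1 f0 addr0.
Qed.

Lemma tlift_tens f : bilin f -> forall u v, tlift f (u ⊗e v) = f u v.
Proof. by move=> bf u v; rewrite /tens tlift_pi // big_seq1. Qed.

Lemma tensor_sum (x : U ⊗ V) : exists s : seq (U * V),
  x = \sum_(p <- s) p.1 ⊗e p.2.
Proof.
have [s ->] := tensor_pi x; exists s.
elim: s => [|[u v] s IH]; first by rewrite big_nil.
by rewrite big_cons -IH /= [RHS]addt_pi.
Qed.

Lemma tlift_sum f : bilin f -> forall s : seq (U * V),
  tlift f (\sum_(p <- s) p.1 ⊗e p.2) = \sum_(p <- s) f p.1 p.2.
Proof.
move=> bf s; rewrite -(tlift_pi bf); congr tlift.
elim: s => [|[u v] s IH]; first by rewrite big_nil.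
by rewrite big_cons IH /= [LHS]addt_pi.
Qed.

Lemma tensor_ext (f g : {linear U ⊗ V -> W}) :
  (forall u v, f (u ⊗e v) = g (u ⊗e v)) -> f =1 g.
Proof.
move=> fg x; have [s ->] := tensor_sum x.
by rewrite !linear_sum; apply: eq_bigr.
Qed.

End Lift.

Lemma tensDl (K : comNzRingType) (U V : lmodType K) (u u' : U) (v : V) :
  (u + u') ⊗e v = u ⊗e v + u' ⊗e v.
Proof. by rewrite -{1}[u]scale1r (tens_bilinear U V).1 /= scale1r. Qed.

Lemma tensDr (K : comNzRingType) (U V : lmodType K) (u : U) (v v' : V) :
  u ⊗e (v + v') = u ⊗e v + u ⊗e v'.
Proof. by rewrite -{1}[v]scale1r (tens_bilinear U V).2 /= scale1r. Qed.

Lemma tens0l (K : comNzRingType) (U V : lmodType K) (v : V) :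
  (0 : U) ⊗e v = 0.
Proof. by apply: (addrI (0 ⊗e v)); rewrite -tensDl !addr0. Qed.

Lemma tens0r (K : comNzRingType) (U V : lmodType K) (u : U) :
  u ⊗e (0 : V) = 0.
Proof. by apply: (addrI (u ⊗e 0)); rewrite -tensDr !addr0. Qed.

Lemma tensZl (K : comNzRingType) (U V : lmodType K) a (u : U) (v : V) :
  (a *: u) ⊗e v = a *: (u ⊗e v).
Proof. by rewrite -[a *: u]addr0 (tens_bilinear U V).1 tens0l addr0. Qed.

Lemma tensZr (K : comNzRingType) (U V : lmodType K) a (u : U) (v : V) :
  u ⊗e (a *: v) = a *: (u ⊗e v).
Proof. by rewrite -[a *: v]addr0 (tens_bilinear U V).2 tens0r addr0. Qed.

Section TensorMaps.
Variables (K : comNzRingType).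
Implicit Types (U V W X : lmodType K).

Definition tmap U U' V V' (f : {linear U -> U'}) (g : {linear V -> V'}) :
  U ⊗ V -> U' ⊗ V' := tlift (fun u v => f u ⊗e g v).

Lemma tmap_bilinear U U' V V' (f : {linear U -> U'}) (g : {linear V -> V'}) :
  bilinear_for *:%R *:%R (fun u v => f u ⊗e g v).
Proof.
split=> [v a x y|u a x y] /=; rewrite linearP.
  by rewrite tensDl tensZl.
by rewrite tensDr tensZr.
Qed.

HB.instance Definition _ U U' V V'
    (f : {linear U -> U'}) (g : {linear V -> V'}) :=
  GRing.isLinear.Build K (U ⊗ V) (U' ⊗ V') *:%R (tmap f g)
    (tlift_linear (tmap_bilinear f g)).

Definition twist U V : U ⊗ V -> V ⊗ U := tlift (fun u v => v ⊗e u).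

Lemma twist_bilinear U V :
  bilinear_for *:%R *:%R (fun (u : U) (v : V) => v ⊗e u).
Proof.
by split=> [v a x y|u a x y] /=; rewrite !(tensDl, tensZl, tensDr, tensZr).
Qed.

HB.instance Definition _ U V :=
  GRing.isLinear.Build K (U ⊗ V) (V ⊗ U) *:%R (@twist U V)
    (tlift_linear (@twist_bilinear U V)).

Definition assocr U V W : (U ⊗ V) ⊗ W -> U ⊗ (V ⊗ W) :=
  tlift (fun x w => tlift (fun u v => u ⊗e (v ⊗e w)) x).

Definition assocl U V W : U ⊗ (V ⊗ W) -> (U ⊗ V) ⊗ W :=
  tlift (fun u y => tlift (fun v w => (u ⊗e v) ⊗e w) y).

Lemma assocr_bilinear1 U V W (w : W) :
  bilinear_for *:%R *:%R (fun (u : U) (v : V) => u ⊗e (v ⊗e w)).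
Proof.
by split=> [v a x y|u a x y] /=; rewrite !(tensDl, tensZl, tensDr, tensZr).
Qed.

Lemma assocl_bilinear1 U V W (u : U) :
  bilinear_for *:%R *:%R (fun (v : V) (w : W) => (u ⊗e v) ⊗e w).
Proof.
by split=> [w a x y|v a x y] /=; rewrite !(tensDl, tensZl, tensDr, tensZr).
Qed.

Lemma assocr_bilinear U V W : bilinear_for *:%R *:%R
  (fun (x : U ⊗ V) (w : W) => tlift (fun u v => u ⊗e (v ⊗e w)) x).
Proof.
split=> [w|x]; first exact: (tlift_linear (assocr_bilinear1 _ _ w)).
move=> a y z; have [s ->] := tensor_sum x.
rewrite !(tlift_sum (assocr_bilinear1 _ _ _)) /= scaler_sumr -big_split /=.
by apply: eq_bigr => p _; rewrite !(tensDr, tensZr).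
Qed.

Lemma assocl_bilinear U V W : bilinear_for *:%R *:%R
  (fun (u : U) (y : V ⊗ W) => tlift (fun v w => (u ⊗e v) ⊗e w) y).
Proof.
split=> [y|u]; last exact: (tlift_linear (assocl_bilinear1 _ _ u)).
move=> a u u'; have [s ->] := tensor_sum y.
rewrite !(tlift_sum (assocl_bilinear1 _ _ _)) /= scaler_sumr -big_split /=.
by apply: eq_bigr => p _; rewrite !(tensDl, tensZl).
Qed.

HB.instance Definition _ U V W :=
  GRing.isLinear.Build K ((U ⊗ V) ⊗ W) (U ⊗ (V ⊗ W)) *:%R (@assocr U V W)
    (tlift_linear (@assocr_bilinear U V W)).

HB.instance Definition _ U V W :=
  GRing.isLinear.Build K (U ⊗ (V ⊗ W)) ((U ⊗ V) ⊗ W) *:%R (@assocl U V W)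
    (tlift_linear (@assocl_bilinear U V W)).

Lemma iter_linear U m (f : {linear U -> U}) : linear (iter m f).
Proof. by elim: m => [|m IH] a x y /=; rewrite ?IH ?linearP. Qed.

HB.instance Definition _ U m (f : {linear U -> U}) :=
  GRing.isLinear.Build K U U *:%R (iter m f) (iter_linear m f).

End TensorMaps.

Arguments twist {K U V}.
Arguments assocr {K U V W}.
Arguments assocl {K U V W}.
Notation "f ⊗m g" := (tmap f g) : ring_scope.

(* Id ⊗ τ ⊗ Id, with the reassociations made explicit; see interchange_tens *)
Definition interchange (K : comNzRingType) (U V W X : lmodType K) :
    {linear (U ⊗ V) ⊗ (W ⊗ X) -> (U ⊗ W) ⊗ (V ⊗ X)} :=
  assocl \o (idfun ⊗m (assocr \o (twist ⊗m idfun) \o assocl)) \o assocr.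

Lemma tmap_tens (K : comNzRingType) (U U' V V' : lmodType K)
    (f : {linear U -> U'}) (g : {linear V -> V'}) u v :
  (f ⊗m g) (u ⊗e v) = f u ⊗e g v.
Proof. exact: (tlift_tens (tmap_bilinear f g)). Qed.

Lemma twist_tens (K : comNzRingType) (U V : lmodType K) (u : U) (v : V) :
  twist (u ⊗e v) = v ⊗e u.
Proof. exact: (tlift_tens (@twist_bilinear K U V)). Qed.

Lemma assocr_tens (K : comNzRingType) (U V W : lmodType K)
    (u : U) (v : V) (w : W) : assocr ((u ⊗e v) ⊗e w) = u ⊗e (v ⊗e w).
Proof.
by rewrite /assocr (tlift_tens (@assocr_bilinear K U V W))
           (tlift_tens (assocr_bilinear1 _ _ w)).
Qed.

Lemma assocl_tens (K : comNzRingType) (U V W : lmodType K)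
    (u : U) (v : V) (w : W) : assocl (u ⊗e (v ⊗e w)) = (u ⊗e v) ⊗e w.
Proof.
by rewrite /assocl (tlift_tens (@assocl_bilinear K U V W))
           (tlift_tens (assocl_bilinear1 _ _ u)).
Qed.

Lemma interchange_tens (K : comNzRingType) (U V W X : lmodType K)
    (u : U) (v : V) (w : W) (x : X) :
  interchange U V W X ((u ⊗e v) ⊗e (w ⊗e x)) = (u ⊗e w) ⊗e (v ⊗e x).
Proof.
by rewrite /= assocr_tens tmap_tens /= assocl_tens tmap_tens /= twist_tens
           assocr_tens assocl_tens.
Qed.

Section HomStructures.
Variable K : comNzRingType.

(* Where the two sides of an axiom lie in X ⊗ (Y ⊗ Z) and (X ⊗ Y) ⊗ Z, the
   customary identification of these modules is spelled out as assocr. *)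
Record hom_associative_algebra (A : lmodType K)
    (mu : {linear A ⊗ A -> A}) (alpha : {linear A -> A}) : Prop := {
  haa_mult : alpha \o mu =1 mu \o (alpha ⊗m alpha);
  haa_assoc :
    mu \o (alpha ⊗m mu) \o assocr =1 mu \o (mu ⊗m alpha)
}.

Record hom_coassociative_coalgebra (C : lmodType K)
    (Delta : {linear C -> C ⊗ C}) (alpha : {linear C -> C}) : Prop := {
  hcc_comult : (alpha ⊗m alpha) \o Delta =1 Delta \o alpha;
  hcc_coassoc :
    (alpha ⊗m Delta) \o Delta =1 assocr \o (Delta ⊗m alpha) \o Delta
}.

Record hom_bialgebra (H : lmodType K) (mu : {linear H ⊗ H -> H})
    (Delta : {linear H -> H ⊗ H}) (alpha : {linear H -> H}) : Prop := {
  hb_algebra : hom_associative_algebra mu alpha;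
  hb_coalgebra : hom_coassociative_coalgebra Delta alpha;
  hb_compat :
    Delta \o mu =1 (mu ⊗m mu) \o interchange H H H H \o (Delta ⊗m Delta)
}.

Record hom_module (H : lmodType K) (muH : {linear H ⊗ H -> H})
    (alphaH : {linear H -> H}) (M : lmodType K) (alphaM : {linear M -> M})
    (rho : {linear H ⊗ M -> M}) : Prop := {
  hm_mult : alphaM \o rho =1 rho \o (alphaH ⊗m alphaM);
  hm_assoc :
    rho \o (alphaH ⊗m rho) \o assocr =1 rho \o (muH ⊗m alphaM)
}.

Record module_hom_algebra (H : lmodType K) (muH : {linear H ⊗ H -> H})
    (DeltaH : {linear H -> H ⊗ H}) (alphaH : {linear H -> H})
    (A : lmodType K) (muA : {linear A ⊗ A -> A}) (alphaA : {linear A -> A})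
    (rho : {linear H ⊗ A -> A}) : Prop := {
  mha_module : hom_module muH alphaH alphaA rho;
  mha_axiom : forall (x : H) (a b : A),
    rho (iter 2 alphaH x ⊗e muA (a ⊗e b)) =
    tlift (fun x1 x2 => muA (rho (x1 ⊗e a) ⊗e rho (x2 ⊗e b))) (DeltaH x)
}.

Lemma module_hom_algebra_axiom_bilinear (H : lmodType K) (A : lmodType K)
    (muA : {linear A ⊗ A -> A}) (rho : {linear H ⊗ A -> A}) (a b : A) :
  bilinear_for *:%R *:%R
    (fun x1 x2 : H => muA (rho (x1 ⊗e a) ⊗e rho (x2 ⊗e b))).
Proof.
by split=> [x2 c x y|x1 c x y] /=;
  rewrite !(tensDl, tensZl, linearP, tensDr, tensZr).
Qed.

End HomStructures.

Definition rho_nk (K : comNzRingType) (H A : lmodType K)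
    (alphaH : {linear H -> H}) (alphaA : {linear A -> A})
    (rho : {linear H ⊗ A -> A}) (n k : nat) : {linear H ⊗ A -> A} :=
  iter (2 ^ k - 1)%N alphaA \o rho \o (iter n alphaH ⊗m idfun).

Definition mu_k (K : comNzRingType) (A : lmodType K)
    (mu : {linear A ⊗ A -> A}) (alpha : {linear A -> A}) (k : nat) :
    {linear A ⊗ A -> A} := iter (2 ^ k - 1)%N alpha \o mu.

Definition Delta_k (K : comNzRingType) (H : lmodType K)
    (Delta : {linear H -> H ⊗ H}) (alpha : {linear H -> H}) (k : nat) :
    {linear H -> H ⊗ H} := Delta \o iter (2 ^ k - 1)%N alpha.

Definition alpha_k (K : comNzRingType) (A : lmodType K)
    (alpha : {linear A -> A}) (k : nat) : {linear A -> A} :=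
  iter (2 ^ k)%N alpha.

(* Main.v *)
Require Import Defs.
From mathcomp Require Import all_boot all_order all_algebra.

(** The theorem is an instance of a twisting principle.  If [beta] commutes
    with the twisting map [alpha] of a Hom-structure and is an endomorphism of
    its operations, then replacing [alpha] by [beta \o alpha], each product
    [mu] by [beta \o mu] and the coproduct [Delta] by [Delta \o beta] gives
    again a Hom-structure of the same kind: every axiom of the new structure is
    the old axiom composed with [beta \o beta], after the copies of [beta]
    inside the tensor factors have been moved to one end of the composite
    ([hom_associative_algebra_twist], [hom_coassociative_coalgebra_twist],
    [hom_bialgebra_twist]).

    The same holds for an action [rho] when it is twisted by a compatible pair
    of endomorphisms [betaH], [betaA].  Independently, the acting elements may
    first be moved by a further endomorphism [gamma] of the Hom-bialgebra
    commuting with [betaH]: this restricts the action along [gamma], so it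
    precomposes both sides of each axiom with [gamma] ([hom_module_twist],
    [module_hom_algebra_twist]).

    All powers of [alpha] are such endomorphisms, since the axioms make [alpha]
    itself multiplicative, comultiplicative and compatible with the action.
    The theorem is the case [beta = alpha ^ (2 ^ k - 1)], for which
    [beta \o alpha = alpha ^ (2 ^ k)], and [gamma = alphaH ^ n].  The exponent
    [2 ^ k - 1] could be any natural number [m], with [m + 1] in place of
    [2 ^ k]. *)

Set Implicit Arguments.
Unset Strict Implicit.
Unset Printing Implicit Defensive.

Import GRing.Theory.
Local Open Scope ring_scope.

(** * Maps out of tensor products *)

(** Equalities between the factors are taken extensionally, so that this
    applies to linear maps whose linear structures are built differently. *)
Lemma tmap_comp (K : comNzRingType) (U U1 U2 V V1 V2 : lmodType K)
    (f : {linear U -> U2}) (f1 : {linear U -> U1}) (f2 : {linear U1 -> U2})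
    (g : {linear V -> V2}) (g1 : {linear V -> V1}) (g2 : {linear V1 -> V2}) :
  f =1 f2 \o f1 -> g =1 g2 \o g1 -> f ⊗m g =1 (f2 ⊗m g2) \o (f1 ⊗m g1).
Proof.
by move=> ef eg; apply: tensor_ext => u v; rewrite /= !tmap_tens ef eg.
Qed.

Lemma tensor_ext3 (K : comNzRingType) (U V W X : lmodType K)
    (f g : {linear (U ⊗ V) ⊗ W -> X}) :
  (forall u v w, f ((u ⊗e v) ⊗e w) = g ((u ⊗e v) ⊗e w)) -> f =1 g.
Proof.
move=> efg; apply: tensor_ext => x w; have [s ->] := tensor_sum x.
have tens_suml : (\sum_(p <- s) p.1 ⊗e p.2) ⊗e w
               = \sum_(p <- s) (p.1 ⊗e p.2) ⊗e w.
  by apply: (big_morph (fun y => y ⊗e w)) => [y z|]; rewrite ?tensDl ?tens0l.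
by rewrite tens_suml !linear_sum; apply: eq_bigr => p _.
Qed.

(** Moves a linear map outside a Sweedler sum, and endomorphisms applied to
    the coproduct, into the summand. *)
Lemma tlift_comp (K : comNzRingType) (U V U' V' W W' : lmodType K)
    (h : {linear W -> W'}) (b : U' -> V' -> W)
    (f : {linear U -> U'}) (g : {linear V -> V'}) :
  bilinear_for *:%R *:%R b ->
  forall x, h (tlift b ((f ⊗m g) x)) = tlift (fun u v => h (b (f u) (g v))) x.
Proof.
move=> bb x; have [s ->] := tensor_sum x.
have bhb : bilinear_for *:%R *:%R (fun u v => h (b (f u) (g v))).
  by split=> [v a y z|u a y z] /=; rewrite linearP ?bb.1 ?bb.2 /= linearP.
rewrite (tlift_sum bhb) [(f ⊗m g) _]linear_sum.
have tmap_s : \sum_(p <- s) (f ⊗m g) (p.1 ⊗e p.2)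
      = \sum_(q <- [seq (f p.1, g p.2) | p <- s]) q.1 ⊗e q.2.
  by rewrite big_map; apply: eq_bigr => p _; rewrite tmap_tens.
by rewrite tmap_s (tlift_sum bb) linear_sum big_map.
Qed.

(** * Twisting Hom-structures along an endomorphism *)

Section Twist.
Variable K : comNzRingType.

Lemma hom_associative_algebra_twist (A : lmodType K) (mu : {linear A ⊗ A -> A})
    (alpha beta alpha' : {linear A -> A}) :
  hom_associative_algebra mu alpha ->
  (forall x, beta (mu x) = mu ((beta ⊗m beta) x)) ->
  (forall x, beta (alpha x) = alpha (beta x)) ->
  alpha' =1 beta \o alpha ->
  hom_associative_algebra (beta \o mu) alpha'.
Proof.
case=> mult assoc bmu bC aE; split=> x /=.
  have {}mult y : mu ((alpha ⊗m alpha) y) = alpha (mu y) by rewrite -[LHS]mult.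
  by rewrite aE (tmap_comp aE aE) /= -bmu mult !bC.
have {}assoc : mu ((alpha ⊗m mu) (assocr x)) = mu ((mu ⊗m alpha) x).
  exact: (assoc x).
by rewrite (tmap_comp (g2 := beta) (g1 := mu) aE) //=
           (tmap_comp (f2 := beta) (f1 := mu) _ aE) //= -!bmu assoc.
Qed.

Lemma hom_coassociative_coalgebra_twist (C : lmodType K)
    (Delta : {linear C -> C ⊗ C}) (alpha beta alpha' : {linear C -> C}) :
  hom_coassociative_coalgebra Delta alpha ->
  (forall x, (beta ⊗m beta) (Delta x) = Delta (beta x)) ->
  (forall x, beta (alpha x) = alpha (beta x)) ->
  alpha' =1 beta \o alpha ->
  hom_coassociative_coalgebra (Delta \o beta) alpha'.
Proof.
case=> comult coassoc bD bC aE.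
have aE' : alpha' =1 alpha \o beta by move=> x; rewrite aE /= bC.
split=> x /=.
  have {}comult y : (alpha ⊗m alpha) (Delta y) = Delta (alpha y).
    by rewrite -[RHS]comult.
  by rewrite (tmap_comp aE' aE') /= bD comult aE' /= !bC.
have {}coassoc y : (alpha ⊗m Delta) (Delta y)
                 = assocr ((Delta ⊗m alpha) (Delta y)).
  exact: (coassoc y).
by rewrite (tmap_comp (g2 := Delta) (g1 := beta) aE') //=
           (tmap_comp (f2 := Delta) (f1 := beta) _ aE') //= bD coassoc.
Qed.

Lemma hom_bialgebra_twist (H : lmodType K) (mu : {linear H ⊗ H -> H})
    (Delta : {linear H -> H ⊗ H}) (alpha beta alpha' : {linear H -> H}) :
  hom_bialgebra mu Delta alpha ->
  (forall x, beta (mu x) = mu ((beta ⊗m beta) x)) ->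
  (forall x, (beta ⊗m beta) (Delta x) = Delta (beta x)) ->
  (forall x, beta (alpha x) = alpha (beta x)) ->
  alpha' =1 beta \o alpha ->
  hom_bialgebra (beta \o mu) (Delta \o beta) alpha'.
Proof.
case=> alg coalg compat bmu bD bC aE; split.
- exact: (hom_associative_algebra_twist alg).
- exact: (hom_coassociative_coalgebra_twist coalg).
move=> x; rewrite -[LHS]/(Delta (beta (beta (mu x)))).
(* The interchange stays in the middle: the copies of [beta] are split off
   before and after it. *)
rewrite -[RHS]/(((beta \o mu) ⊗m (beta \o mu))
  (Defs.interchange H H H H (((Delta \o beta) ⊗m (Delta \o beta)) x))).
rewrite (tmap_comp (f2 := beta) (f1 := mu) (g2 := beta) (g1 := mu)) //.
rewrite (tmap_comp (f2 := Delta) (f1 := beta) (g2 := Delta) (g1 := beta)) //.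
rewrite -[RHS]/((beta ⊗m beta) (((mu ⊗m mu) \o Defs.interchange H H H H
                  \o (Delta ⊗m Delta)) ((beta ⊗m beta) x))).
by rewrite -compat /= bD bmu.
Qed.

(** [betaH] and [gamma] play different roles: [betaH] has to match the [betaM]
    outside the action, while [gamma] has no counterpart on [M] and survives as
    [gamma h1], [gamma h2] in the instance of Hom-associativity that is used. *)
Lemma hom_module_twist (H : lmodType K) (muH : {linear H ⊗ H -> H})
    (alphaH betaH gamma alphaH' : {linear H -> H}) (M : lmodType K)
    (alphaM betaM alphaM' : {linear M -> M}) (rho : {linear H ⊗ M -> M}) :
  hom_module muH alphaH alphaM rho ->
  (forall x, betaM (rho x) = rho ((betaH ⊗m betaM) x)) ->
  (forall x, gamma (muH x) = muH ((gamma ⊗m gamma) x)) ->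
  (forall x, betaM (alphaM x) = alphaM (betaM x)) ->
  (forall x, gamma (alphaH x) = alphaH (gamma x)) ->
  (forall x, gamma (betaH x) = betaH (gamma x)) ->
  alphaH' =1 betaH \o alphaH ->
  alphaM' =1 betaM \o alphaM ->
  hom_module (betaH \o muH) alphaH' alphaM'
    (betaM \o rho \o (gamma ⊗m idfun)).
Proof.
case=> mult assoc brho gmu bCM gCa gCb aHE aME.
have brhoE h m : rho (betaH h ⊗e betaM m) = betaM (rho (h ⊗e m)).
  by rewrite brho tmap_tens.
have multE h m : rho (alphaH h ⊗e alphaM m) = alphaM (rho (h ⊗e m)).
  by rewrite -tmap_tens -[LHS]mult.
have gaH' h : gamma (alphaH' h) = betaH (alphaH (gamma h)).
  by rewrite aHE /= gCb gCa.
split.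
  apply: tensor_ext => h m; rewrite /= !tmap_tens /=.
  by rewrite gaH' !aME /= brhoE multE !bCM.
apply: tensor_ext3 => h1 h2 m.
rewrite /= assocr_tens !tmap_tens /= !tmap_tens /=.
have := assoc ((gamma h1 ⊗e gamma h2) ⊗e m).
rewrite /= assocr_tens !tmap_tens /= => assocE.
by rewrite gaH' gCb gmu tmap_tens aME /= !brhoE assocE.
Qed.

(** Both sides reduce to [betaA \o betaA] applied to the Sweedler sum of the
    original axiom at [gamma (betaH x)]. *)
Lemma module_hom_algebra_twist (H : lmodType K) (muH : {linear H ⊗ H -> H})
    (DeltaH : {linear H -> H ⊗ H})
    (alphaH betaH gamma alphaH' : {linear H -> H})
    (A : lmodType K) (muA : {linear A ⊗ A -> A})
    (alphaA betaA alphaA' : {linear A -> A}) (rho : {linear H ⊗ A -> A}) :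
  module_hom_algebra muH DeltaH alphaH muA alphaA rho ->
  (forall x, betaA (rho x) = rho ((betaH ⊗m betaA) x)) ->
  (forall x, betaA (muA x) = muA ((betaA ⊗m betaA) x)) ->
  (forall x, gamma (muH x) = muH ((gamma ⊗m gamma) x)) ->
  (forall x, (gamma ⊗m gamma) (DeltaH x) = DeltaH (gamma x)) ->
  (forall x, betaA (alphaA x) = alphaA (betaA x)) ->
  (forall x, betaH (alphaH x) = alphaH (betaH x)) ->
  (forall x, gamma (alphaH x) = alphaH (gamma x)) ->
  (forall x, gamma (betaH x) = betaH (gamma x)) ->
  alphaH' =1 betaH \o alphaH ->
  alphaA' =1 betaA \o alphaA ->
  module_hom_algebra (betaH \o muH) (DeltaH \o betaH) alphaH'
    (betaA \o muA) alphaA' (betaA \o rho \o (gamma ⊗m idfun)).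
Proof.
case=> modA ax brho bmu gmu gD bCA bCH gCa gCb aHE aAE; split.
  exact: (hom_module_twist modA).
move=> x a b; rewrite /= tmap_tens /=.
have brhoE h c : rho (betaH h ⊗e betaA c) = betaA (rho (h ⊗e c)).
  by rewrite brho tmap_tens.
(* One factor [betaH] of [alphaH' ^ 2] pairs with the [betaA] of the twisted
   product of [A]; the other one is the [betaH] of the twisted coproduct. *)
have gaH' : gamma (alphaH' (alphaH' x))
          = betaH (iter 2 alphaH (gamma (betaH x))).
  by rewrite !aHE /= !(gCb, gCa) !bCH.
rewrite gaH' brhoE ax -gD.
rewrite -[LHS]/((betaA \o betaA) _) tlift_comp; last first.
  exact: module_hom_algebra_axiom_bilinear.
apply: eq_bigr => p _ /=.
by rewrite !tmap_tens /= [betaA (muA _)]bmu tmap_tens.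
Qed.

End Twist.

(** * Powers of the twisting map *)

Section Powers.
Variable K : comNzRingType.

Lemma iter_comm (T : Type) (f g : T -> T) m :
  f \o g =1 g \o f -> iter m f \o g =1 g \o iter m f.
Proof. by move=> fg x /=; elim: m => //= m ->; exact: fg. Qed.

Lemma iter_tmap (U V : lmodType K) (f : {linear U -> U}) (g : {linear V -> V})
    m :
  iter m f ⊗m iter m g =1 iter m (f ⊗m g).
Proof.
apply: tensor_ext => u v; rewrite /= tmap_tens.
by elim: m => //= m <-; rewrite tmap_tens.
Qed.

(** Covers products and actions alike. *)
Lemma iter_mult (U V : lmodType K) (f : {linear U -> U})
    (g : {linear V -> V}) (b : {linear U ⊗ V -> V}) :
  g \o b =1 b \o (f ⊗m g) ->
  forall m, iter m g \o b =1 b \o (iter m f ⊗m iter m g).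
Proof.
by move=> gb m x; rewrite /= iter_tmap; elim: m => //= m ->; exact: gb.
Qed.

Lemma iter_comult (U : lmodType K) (f : {linear U -> U})
    (D : {linear U -> U ⊗ U}) :
  (f ⊗m f) \o D =1 D \o f ->
  forall m, (iter m f ⊗m iter m f) \o D =1 D \o iter m f.
Proof.
by move=> fD m x; rewrite /= iter_tmap; elim: m => //= m ->; exact: fD.
Qed.

Lemma alpha_kE (A : lmodType K) (alpha : {linear A -> A}) k :
  alpha_k alpha k =1 iter (2 ^ k - 1) alpha \o alpha.
Proof.
by move=> x; rewrite /= -iterSr subn1 prednK // expn_gt0.
Qed.

End Powers.

Theorem theorem5p5 (K : comNzRingType)
    (char0 : forall m : nat, m%:R = 0 :> K -> m = 0%N)
    (H : lmodType K) (muH : {linear H ⊗ H -> H})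
    (DeltaH : {linear H -> H ⊗ H}) (alphaH : {linear H -> H})
    (A : lmodType K) (muA : {linear A ⊗ A -> A}) (alphaA : {linear A -> A})
    (rho : {linear H ⊗ A -> A})
    (bialgH : hom_bialgebra muH DeltaH alphaH)
    (algA : hom_associative_algebra muA alphaA)
    (modA : module_hom_algebra muH DeltaH alphaH muA alphaA rho)
    (n k : nat) :
  [/\ hom_associative_algebra (mu_k muA alphaA k) (alpha_k alphaA k),
      hom_bialgebra (mu_k muH alphaH k) (Delta_k DeltaH alphaH k)
        (alpha_k alphaH k)
    & module_hom_algebra (mu_k muH alphaH k) (Delta_k DeltaH alphaH k)
        (alpha_k alphaH k) (mu_k muA alphaA k) (alpha_k alphaA k)
        (rho_nk alphaH alphaA rho n k)].
Proof.
have commA m : iter m alphaA \o alphaA =1 alphaA \o iter m alphaA.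
  exact: iter_comm.
have commH m : iter m alphaH \o alphaH =1 alphaH \o iter m alphaH.
  exact: iter_comm.
have multA := iter_mult (haa_mult algA).
have multH := iter_mult (haa_mult (hb_algebra bialgH)).
have comultH := iter_comult (hcc_comult (hb_coalgebra bialgH)).
have actA := iter_mult (hm_mult (mha_module modA)).
split.
- exact: (hom_associative_algebra_twist algA (multA _) (commA _)
           (alpha_kE _ _)).
- exact: (hom_bialgebra_twist bialgH (multH _) (comultH _) (commH _)
           (alpha_kE _ _)).
- apply: (module_hom_algebra_twist modA (actA _) (multA _) (multH n)
           (comultH n) (commA _) (commH _) (commH n) _
           (alpha_kE _ _) (alpha_kE _ _)).
  by apply: iter_comm => x; rewrite [RHS]commH.
Qed.
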